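(* Let $1\le d\le n$ be integers and let $X_1,X_2,\ldots,X_n$ be i.i.d. real-valued random variables. Suppose $\psi:\mathbb{R}^d\to\mathbb{R}$ is a symmetric measurable function with $\|\psi\|_\infty\le b$. Assume $E\psi(X_1,X_2,\ldots,X_d)=0$ and $P\big(E(\psi(X_1,X_2,\ldots,X_d)\mid X_1)=0\big)<1$. Let $$W_d=n^{1/2}\binom{n}{d}^{-1}\sum_{1\le j_1<j_2<\cdots<j_d\le n}\psi(X_{j_1},X_{j_2},\ldots,X_{j_d}).$$ Then for all $t\ge 0$, $$P(W_d\ge t)\le\exp\left(-\frac{t^2\kappa_d^{1/2}}{8b^2\gamma_d^2}\right)\quad\text{and}\quad P(W_d\le -t)\le\exp\left(-\frac{t^2\kappa_d^{1/2}}{8b^2\gamma_d^2}\right),$$ where $$\gamma_d=\left(\frac{d(d+1)(2d+1)}{6}\right)^{1/2}\quad\text{and}\quad\kappa_d=\frac{(d!)^2\,3^{d-1}}{(d(d+1)(2d+1))^{d-1}}.$$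
   Context: Symmetric means that $\psi$ is invariant under all permutations of its $d$ arguments; $\|\psi\|_\infty$ is the supremum norm of $\psi$. *)

(* Defs.v *)
From HB Require Import structures.
From mathcomp Require Import all_boot all_order all_algebra all_fingroup.
From mathcomp Require Import all_classical all_reals all_analysis.

Set Implicit Arguments.
Unset Strict Implicit.
Unset Printing Implicit Defensive.

Import Order.TTheory GRing.Theory Num.Theory.
Import numFieldNormedType.Exports.

Local Open Scope classical_set_scope.
Local Open Scope ring_scope.

(* Taken in \bar R, so that an unbounded function has norm +oo. *)
Definition sup_norm (R : realType) (U : Type) (f : U -> R) : \bar R :=
  ereal_sup (range (fun x => `|f x|%:E)).

Definition symmetric_fun (A B : Type) (d : nat) (f : d.-tuple A -> B) : Prop :=
  forall (s : 'S_d) (x : d.-tuple A),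
    f [tuple tnth x (s k) | k < d] = f x.

Definition mutually_independent (disp disp' : measure_display)
    (T : measurableType disp) (U : measurableType disp') (R : realType)
    (P : probability T R) (I : finType) (X : I -> {RV P >-> U}) : Prop :=
  forall (J : {set I}) (B : I -> set U),
    (forall i, i \in J -> measurable (B i)) ->
    P (\bigcap_(i in [set` J]) (X i @^-1` B i)) =
    (\prod_(i in J) P (X i @^-1` B i))%E.

Definition identically_distributed (disp disp' : measure_display)
    (T : measurableType disp) (U : measurableType disp') (R : realType)
    (P : probability T R) (I : finType) (X : I -> {RV P >-> U}) : Prop :=
  forall (i j : I) (B : set U), measurable B ->
    distribution P (X i) B = distribution P (X j) B.

Definition iid (disp disp' : measure_display)
    (T : measurableType disp) (U : measurableType disp') (R : realType)
    (P : probability T R) (I : finType) (X : I -> {RV P >-> U}) : Prop :=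
  mutually_independent X /\ identically_distributed X.

Definition sigma_of (disp disp' : measure_display)
    (T : measurableType disp) (U : measurableType disp') (R : realType)
    (P : probability T R) (X : {RV P >-> U}) : set_system T :=
  preimage_set_system setT X measurable.

(* [Y] is a version of the conditional expectation of [Z] given the
   sub-sigma-algebra [G]; versions are unique up to [P]-null sets. *)
Definition is_cond_expectation (disp : measure_display)
    (T : measurableType disp) (R : realType) (P : probability T R)
    (G : set_system T) (Z Y : T -> R) : Prop :=
  [/\ forall B : set R, measurable B -> G (Y @^-1` B),
      P.-integrable setT (EFin \o Y) &
      forall A : set T, G A ->
        (\int[P]_(w in A) (Y w)%:E = \int[P]_(w in A) (Z w)%:E)%E].

Definition apply_rv (T A B : Type) (d : nat) (psi : d.-tuple A -> B)
    (X : 'I_d -> T -> A) (w : T) : B :=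
  psi [tuple X k w | k < d].

(* The increasing [d]-tuples of elements of ['I_n] index the sum over
   1 <= j_1 < ... < j_d <= n. *)
Definition W_stat (R : realType) (T : Type) (n d : nat)
    (psi : d.-tuple R -> R) (X : 'I_n -> T -> R) (w : T) : R :=
  Num.sqrt n%:R * ('C(n, d)%:R)^-1 *
  \sum_(j : d.-tuple 'I_n | sorted ltn (map val j))
     apply_rv psi (fun k => X (tnth j k)) w.

Definition gamma_ (R : realType) (d : nat) : R :=
  Num.sqrt ((d * (d + 1) * (2 * d + 1))%N%:R / 6).

Definition kappa_ (R : realType) (d : nat) : R :=
  ((d`!)%:R ^+ 2 * 3 ^+ d.-1) / (d * (d + 1) * (2 * d + 1))%N%:R ^+ d.-1.

(* Main.v *)
(* Hoeffding's block argument. With k = floor(n/d), the U-statistic is the average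
   over all permutations s of {1..n} of the mean of psi over k disjoint blocks of
   d variables among X_s(1), ..., X_s(n). By convexity of exp its moment
   generating function is at most the average of those of the block means, each
   of which factorizes by independence. From e^x <= x + e^(2x^2) a centred
   variable bounded by b satisfies E e^(l psi) <= e^(2 l^2 b^2), so
   P(W_d >= t) <= exp(- t^2 (k/n) / (8 b^2)). Finally kappa_d <= 1, and
   k/n >= 1/(2d) >= 1/gamma_d^2 for d >= 2 while k/n = 1/gamma_d^2 for d = 1, so
   that k/n >= kappa_d^(1/2) / gamma_d^2. *)
Require Import Defs.
From HB Require Import structures.
From mathcomp Require Import all_boot all_order all_algebra all_fingroup.
From mathcomp Require Import all_classical all_reals all_analysis.
From mathcomp Require Import measurable_realfun.
From mathcomp Require Import ring lra zify.

Set Implicit Arguments.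
Unset Strict Implicit.
Unset Printing Implicit Defensive.

Import Order.TTheory GRing.Theory Num.Theory.
Import numFieldNormedType.Exports.

Local Open Scope classical_set_scope.
Local Open Scope ring_scope.

(** * Measures on tuple spaces and independence *)

Lemma measurable_box (disp : measure_display) (U : measurableType disp)
    (n : nat) (B : 'I_n -> set U) :
  (forall i, measurable (B i)) ->
  measurable [set x : n.-tuple U | forall i, B i (tnth x i)].
Proof.
move=> mB.
rewrite (_ : mkset _ = \bigcap_(i in setT) ((@tnth n U)^~ i @^-1` B i)).
  apply: fin_bigcap_measurable => // i _.
  by rewrite -[X in measurable X]setTI; exact: measurable_tnth.
by apply/seteqP; split => x /= xB i => [_|]; exact: xB.
Qed.

(** Measurable boxes are stable under intersection, contain [setT] and generate the tuple
    sigma-algebra, so the uniqueness theorem for finite measures applies. *)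
Lemma measure_tuple_unique (disp : measure_display) (U : measurableType disp)
    (R : realType) (n : nat) (m1 m2 : {measure set (n.-tuple U) -> \bar R}) :
  (m1 setT < +oo)%E ->
  (forall B : 'I_n -> set U, (forall i, measurable (B i)) ->
     m1 [set x | forall i, B i (tnth x i)] =
     m2 [set x | forall i, B i (tnth x i)]) ->
  forall A, measurable A -> m1 A = m2 A.
Proof.
move=> m1oo m12 A mA.
pose box (B : 'I_n -> set U) := [set x : n.-tuple U | forall i, B i (tnth x i)].
pose G := [set box B | B in [set B | forall i, measurable (B i)]].
have boxT : G setT.
  by exists (fun=> setT) => //=; apply/seteqP; split.
apply: (measure_unique G (fun=> setT)) => //.
- apply/seteqP; split.
  + apply: smallest_sub; first exact: smallest_sigma_algebra.
    move=> C; rewrite -bigcup_seq/= => -[i _ [D mD <-]].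
    apply: sub_sigma_algebra.
    (* A generating cylinder constrains one coordinate; it is the box that is [setT] in every other
       slot. *)
    exists (fun j => if j == i then D else setT) => [j|]; first by case: ifP.
    rewrite setTI; apply/seteqP; split => x /=.
      by move=> /(_ i); rewrite eqxx.
    by move=> Dx j; case: ifP => // /eqP ->.
  + apply: smallest_sub; first exact: sigma_algebra_measurable.
    by move=> _ [B mB <-]; exact: measurable_box.
- move=> _ _ [B mB <-] [C mC <-].
  exists (fun i => B i `&` C i) => [i|]; first exact: measurableI.
  by apply/seteqP; split => x /= => [BC|[xB xC] i]; [split=> i; have [] := BC i|split].
- exact: bigcup_const.
- by move=> _ [B mB <-]; exact: m12.
Qed.

(** As functions of [S], both sides are finite measures: the image under [Z] of [P] restricted to
    [E], and the law of [Z] scaled by [P E]. Agreement on boxes therefore suffices. *)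
Lemma probability_tuple_indep (disp disp' : measure_display)
    (T : measurableType disp) (U : measurableType disp') (R : realType)
    (P : probability T R) (n : nat) (Z : {RV P >-> n.-tuple U}) (E : set T) :
  measurable E ->
  (forall B : 'I_n -> set U, (forall i, measurable (B i)) ->
     P ((Z @^-1` [set x | forall i, B i (tnth x i)]) `&` E) =
     (P (Z @^-1` [set x | forall i, B i (tnth x i)]) * P E)%E) ->
  forall S, measurable S -> P (Z @^-1` S `&` E) = (P (Z @^-1` S) * P E)%E.
Proof.
move=> mE ZE S mS.
have PE0 : 0 <= fine (P E) by rewrite fine_ge0.
have PEE : (fine (P E))%:E = P E by rewrite fineK// fin_num_measure.
pose mpush : {measure set _ -> \bar R} := pushforward (mrestr P mE) Z.
pose m1 := mpush (measurable_funPT Z).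
pose m2 : {measure set _ -> \bar R} := mscale (NngNum PE0) (distribution P Z).
transitivity (m1 S) => //.
transitivity (m2 S); last by rewrite /m2/= /mscale/= PEE muleC.
apply: measure_tuple_unique => //.
  rewrite /m1/mpush/= /pushforward/= preimage_setT /mrestr setTI.
  by rewrite -ge0_fin_numE// fin_num_measure.
by move=> B mB; rewrite /m1/mpush /m2/= /mscale/= PEE muleC; exact: ZE.
Qed.

(** The hypothesis identifies the law of the pair with the product of the two laws; Tonelli then
    separates the factors. *)
Lemma ge0_integralM_indep (disp d1 d2 : measure_display)
    (T : measurableType disp) (U1 : measurableType d1) (U2 : measurableType d2)
    (R : realType) (P : probability T R)
    (Z1 : {RV P >-> U1}) (Z2 : {RV P >-> U2}) (f1 : U1 -> \bar R)
    (f2 : U2 -> \bar R) :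
  (forall S1 S2, measurable S1 -> measurable S2 ->
     P (Z1 @^-1` S1 `&` Z2 @^-1` S2) =
     (P (Z1 @^-1` S1) * P (Z2 @^-1` S2))%E) ->
  measurable_fun [set: U1] f1 -> measurable_fun [set: U2] f2 ->
  (forall x, 0 <= f1 x)%E -> (forall x, 0 <= f2 x)%E ->
  (\int[P]_w (f1 (Z1 w) * f2 (Z2 w)) =
   (\int[P]_w f1 (Z1 w)) * \int[P]_w f2 (Z2 w))%E.
Proof.
move=> Z12 mf1 mf2 f1_ge0 f2_ge0.
have mZ : measurable_fun setT (fun w => (Z1 w, Z2 w)).
  by apply/measurable_fun_pairP; split; exact: measurable_funPT.
pose mpush : {measure set _ -> \bar R} :=
  pushforward P (fun w => (Z1 w, Z2 w)).
pose m := mpush mZ.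
have mf : measurable_fun setT (fun z : U1 * U2 => f1 z.1 * f2 z.2)%E.
  by apply: emeasurable_funM; [exact: measurableT_comp mf1 _|
                               exact: measurableT_comp mf2 _].
have f_ge0 (z : U1 * U2) : (0 <= f1 z.1 * f2 z.2)%E by exact: mule_ge0.
transitivity (\int[m]_z (f1 z.1 * f2 z.2))%E.
  by rewrite ge0_integral_pushforward// => z _; exact: f_ge0.
transitivity (\int[distribution P Z1 \x distribution P Z2]_z
    (f1 z.1 * f2 z.2))%E.
  apply: eq_measure_integral => A mA _; apply/esym.
  exact: product_measure_unique.
rewrite fubini_tonelli1//= /fubini_F/=.
under eq_integral do rewrite ge0_integralZl//.
rewrite ge0_integralZr//; last exact: integral_ge0.
by rewrite !ge0_integral_distribution.
Qed.

(* Keeping all [n] slots, with the coordinates outside [A] frozen at [u0], makes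
   functions of [(X_i)_(i in A)] functions on a single tuple type. *)
Definition masked (T U : Type) (n : nat) (u0 : U) (X : 'I_n -> T -> U)
    (A : {set 'I_n}) (w : T) : n.-tuple U :=
  [tuple if i \in A then X i w else u0 | i < n].

(** * Disjoint blocks of coordinates of an independent family *)

Section Blocks.
Context (disp disp' : measure_display) (T : measurableType disp)
  (U : measurableType disp') (R : realType) (P : probability T R) (n : nat)
  (X : 'I_n -> {RV P >-> U}).
Hypothesis X_indep : mutually_independent X.

Lemma measurable_masked (u0 : U) (A : {set 'I_n}) :
  measurable_fun setT (masked u0 X A).
Proof.
apply/measurable_fun_tnthP => i.
have -> : @tnth n U ^~ i \o masked u0 X A = if i \in A then X i : T -> U else cst u0.
  by apply/funext => w /=; rewrite tnth_mktuple; case: ifP.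
by case: ifP => _ //; exact: measurable_cst.
Qed.

Lemma masked_boxE (u0 : U) (A : {set 'I_n}) (B : 'I_n -> set U) :
  (forall i, i \notin A -> B i u0) ->
  masked u0 X A @^-1` [set x | forall i, B i (tnth x i)] =
  \bigcap_(i in [set` A]) (X i @^-1` B i).
Proof.
move=> Bu0; apply/seteqP; split => w /= wB i.
  by move=> iA; have := wB i; rewrite tnth_mktuple iA.
by rewrite tnth_mktuple; case: ifPn => [iA|]; [exact: wB|exact: Bu0].
Qed.

Lemma masked_box0 (u0 : U) (A : {set 'I_n}) (B : 'I_n -> set U) i :
  i \notin A -> ~ B i u0 ->
  masked u0 X A @^-1` [set x | forall i, B i (tnth x i)] = set0.
Proof.
move=> iA nB; rewrite -subset0 => w /= /(_ i).
by rewrite tnth_mktuple (negbTE iA).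
Qed.

(** If a frozen slot violates its constraint, one event is empty and both sides vanish. Otherwise
    the events constrain only [A1] and [A2], and merge into a single intersection over the union, to
    which mutual independence applies. *)
Lemma masked_indep_box (u0 : U) (A1 A2 : {set 'I_n}) (B1 B2 : 'I_n -> set U) :
  [disjoint A1 & A2]%B ->
  (forall i, measurable (B1 i)) -> (forall i, measurable (B2 i)) ->
  let E1 := masked u0 X A1 @^-1` [set x | forall i, B1 i (tnth x i)] in
  let E2 := masked u0 X A2 @^-1` [set x | forall i, B2 i (tnth x i)] in
  P (E1 `&` E2) = (P E1 * P E2)%E.
Proof.
move=> A12 mB1 mB2 /=.
have [B1u|/existsNP[i /not_implyP[iA nB]]] :=
    pselect (forall i, i \notin A1 -> B1 i u0); last first.
  by rewrite (masked_box0 iA nB) set0I measure0 mul0e.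
have [B2u|/existsNP[i /not_implyP[iA nB]]] :=
    pselect (forall i, i \notin A2 -> B2 i u0); last first.
  by rewrite (masked_box0 iA nB) setI0 measure0 mule0.
rewrite !masked_boxE// !X_indep//.
pose B i := if i \in A1 then B1 i else B2 i.
have BA2 i : i \in A2 -> B i = B2 i.
  by move=> iA2; rewrite /B (disjointFl A12 iA2).
transitivity (P (\bigcap_(i in [set` A1 :|: A2]) (X i @^-1` B i))).
  congr (P _); apply/seteqP; split => w /=.
    move=> [w1 w2] i /=; rewrite inE /B; case: ifPn => iA1 /=.
      by move=> _; exact: w1.
    exact: w2.
  move=> wB; split=> i /= iA.
    by have := wB i; rewrite /B/= inE iA; exact.
  by rewrite -BA2//; apply: wB; rewrite /= inE iA orbT.
rewrite X_indep => [|i _]; last by rewrite /B; case: ifP.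
rewrite (eq_bigl _ _ (fun i => finset.in_setU i A1 A2)) bigU//=.
congr (_ * _)%E; apply: eq_bigr => i iA.
  by rewrite /B iA.
by rewrite BA2.
Qed.

(** Boxes are upgraded to measurable sets one factor at a time: first [S1] with an arbitrary
    measurable second event, then, after exchanging the roles, [S2] against a fixed box. *)
Lemma masked_indep (u0 : U) (A1 A2 : {set 'I_n}) (S1 S2 : set (n.-tuple U)) :
  [disjoint A1 & A2]%B -> measurable S1 -> measurable S2 ->
  P (masked u0 X A1 @^-1` S1 `&` masked u0 X A2 @^-1` S2) =
  (P (masked u0 X A1 @^-1` S1) * P (masked u0 X A2 @^-1` S2))%E.
Proof.
move=> A12 mS1 mS2.
pose Z A : {RV P >-> n.-tuple U} :=
  HB.pack (masked u0 X A)
    (isMeasurableFun.Build _ _ _ _ _ (measurable_masked u0 A)).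
have mZ A S : measurable S -> measurable (masked u0 X A @^-1` S).
  by move=> mS; rewrite -[X in measurable X]setTI; exact: measurable_masked.
apply: (@probability_tuple_indep _ _ _ _ _ _ _ (Z A1)) => //; first exact: mZ.
move=> B1 mB1; rewrite setIC [RHS]muleC.
apply: (@probability_tuple_indep _ _ _ _ _ _ _ (Z A2)) => //.
  by apply: mZ; exact: measurable_box.
by move=> B2 mB2; rewrite setIC [RHS]muleC; exact: masked_indep_box.
Qed.

Lemma measurable_apply_rv (d : nat) (f : d.-tuple U -> R) (j : d.-tuple 'I_n) :
  measurable_fun setT f ->
  measurable_fun setT (apply_rv f (fun k => X (tnth j k))).
Proof.
move=> mf; apply: (measurableT_comp mf).
apply/measurable_fun_tnthP => k.
rewrite (_ : _ \o _ = X (tnth j k))//.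
by apply/funext => w /=; rewrite tnth_mktuple.
Qed.

Lemma masked_apply_rv (d : nat) (f : d.-tuple U -> R) (u0 : U)
    (A : {set 'I_n}) (j : d.-tuple 'I_n) (w : T) :
  {subset j <= A} ->
  apply_rv f (fun k => X (tnth j k)) w =
  f [tuple tnth (masked u0 X A w) (tnth j k) | k < d].
Proof.
move=> jA; congr f; apply: eq_from_tnth => k.
by rewrite !tnth_mktuple jA// mem_tnth.
Qed.

(** Induction on the list: since no index repeats in the concatenation, the head block and the union
    of the remaining ones use disjoint coordinates, so the head factor splits off. *)
Lemma integral_prod_blocks (u0 : U) (d : nat) (f : d.-tuple U -> R)
    (js : seq (d.-tuple 'I_n)) :
  measurable_fun setT f -> (forall x, 0 <= f x) ->
  uniq (flatten (map val js)) ->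
  (\int[P]_w (\prod_(j <- js) apply_rv f (fun k => X (tnth j k)) w)%:E =
   \prod_(j <- js) \int[P]_w (apply_rv f (fun k => X (tnth j k)) w)%:E)%E.
Proof.
move=> mf f_ge0; elim: js => [|j js IHjs].
  move=> _; under eq_integral do rewrite big_nil.
  by rewrite big_nil integral_cst// mul1e; exact: probability_setT.
rewrite /= cat_uniq => /and3P[_ jjs ujs].
rewrite big_cons -IHjs//.
pose A1 := [set i in j]%SET; pose A2 := [set i in flatten (map val js)]%SET.
pose proj (z : n.-tuple U) (l : d.-tuple 'I_n) :=
  f [tuple tnth z (tnth l k) | k < d].
have mproj l : measurable_fun setT (proj ^~ l).
  apply: (measurableT_comp mf); apply/measurable_fun_tnthP => k.
  rewrite (_ : _ \o _ = (@tnth n U)^~ (tnth l k)); first exact: measurable_tnth.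
  by apply/funext => z /=; rewrite tnth_mktuple.
pose h (z : n.-tuple U) := \prod_(l <- js) proj z l.
have mh : measurable_fun setT h by exact: measurable_prod.
have h_ge0 z : 0 <= h z by rewrite /h; apply: prodr_ge0 => l _; exact: f_ge0.
have A12 : [disjoint A1 & A2]%B.
  rewrite disjoint_subset; apply/fintype.subsetP => i; rewrite !inE => ij.
  by apply: contra jjs => ijs; apply/hasP; exists i.
pose Z A : {RV P >-> n.-tuple U} :=
  HB.pack (masked u0 X A)
    (isMeasurableFun.Build _ _ _ _ _ (measurable_masked u0 A)).
have jE w : apply_rv f (fun k => X (tnth j k)) w = proj (Z A1 w) j.
  by apply: masked_apply_rv => i; rewrite inE.
have jsE w : \prod_(l <- js) apply_rv f (fun k => X (tnth l k)) w = h (Z A2 w).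
  rewrite /h !big_seq; apply: eq_bigr => l ljs; apply: masked_apply_rv => i il.
  by rewrite inE; apply/flattenP; exists (val l) => //; apply/mapP; exists l.
under eq_integral do rewrite big_cons jE jsE EFinM.
rewrite (@ge0_integralM_indep _ _ _ _ _ _ _ _ (Z A1) (Z A2)
  (fun z => (proj z j)%:E) (fun z => (h z)%:E)).
- by congr (_ * _)%E; apply: eq_integral => w _; rewrite ?jE ?jsE.
- by move=> S1 S2 mS1 mS2; exact: (masked_indep u0 A12 mS1 mS2).
- exact/measurable_EFinP.
- exact/measurable_EFinP.
- by move=> z; rewrite lee_fin; exact: f_ge0.
- by move=> z; rewrite lee_fin; exact: h_ge0.
Qed.

(** With distinct indices, the law of the subtuple gives each box the product of its marginal
    probabilities, and the marginals do not depend on the index. *)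
Lemma integral_uniq_tuple (d : nat) (f : d.-tuple U -> R)
    (j1 j2 : d.-tuple 'I_n) :
  identically_distributed X -> measurable_fun setT f -> (forall x, 0 <= f x) ->
  uniq j1 -> uniq j2 ->
  (\int[P]_w (apply_rv f (fun k => X (tnth j1 k)) w)%:E =
   \int[P]_w (apply_rv f (fun k => X (tnth j2 k)) w)%:E)%E.
Proof.
move=> X_id mf f_ge0 u1 u2.
have mjoint (j : d.-tuple 'I_n) :
    measurable_fun setT (fun w => [tuple X (tnth j k) w | k < d]).
  apply/measurable_fun_tnthP => k.
  rewrite (_ : _ \o _ = X (tnth j k))//.
  by apply/funext => w /=; rewrite tnth_mktuple.
pose Z j : {RV P >-> d.-tuple U} :=
  HB.pack (fun w => [tuple X (tnth j k) w | k < d])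
    (isMeasurableFun.Build _ _ _ _ _ (mjoint j)).
have PZ (j : d.-tuple 'I_n) (B : 'I_d -> set U) : uniq j ->
    (forall k, measurable (B k)) ->
    distribution P (Z j) [set x | forall k, B k (tnth x k)] =
    (\prod_(k < d) distribution P (X (tnth j k)) (B k))%E.
  move=> uj mB.
  (* Constraints are moved from positions to indices; distinctness makes the position of an index
     unique, and the default [set0] falls outside the range of the intersection. *)
  pose B' i := if [pick k | tnth j k == i] is Some k then B k else set0.
  have B'E k : B' (tnth j k) = B k.
    rewrite /B'; case: pickP => [l /eqP|/(_ k)]; last by rewrite eqxx.
    by move/tuple_uniqP : uj => /[apply] ->.
  have mB' i : measurable (B' i) by rewrite /B'; case: pickP.
  transitivity (P (\bigcap_(i in [set` [set i in j]%SET]) (X i @^-1` B' i))).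
    congr (P _); apply/seteqP; split => w /= wB.
      move=> i /=; rewrite inE => /tnthP[k ->] /=; rewrite B'E.
      by have := wB k; rewrite tnth_mktuple.
    move=> k; rewrite tnth_mktuple -B'E; apply: wB.
    by rewrite /= inE mem_tnth.
  rewrite X_indep//.
  rewrite (eq_bigl (fun i => i \in tval j)); last by move=> i; rewrite inE.
  rewrite -big_uniq// big_tuple; apply: eq_bigr => k _.
  by rewrite B'E.
have EZ j : (\int[P]_w (apply_rv f (fun k => X (tnth j k)) w)%:E =
    \int[distribution P (Z j)]_x (f x)%:E)%E.
  by rewrite ge0_integral_distribution//; exact/measurable_EFinP.
rewrite !EZ.
apply: eq_measure_integral => A mA _.
apply: measure_tuple_unique => //.
  by rewrite [ltLHS]probability_setT ltry.
move=> B mB; rewrite [LHS](PZ j1)// [RHS](PZ j2)//.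
by apply: eq_bigr => k _; exact: X_id.
Qed.
End Blocks.

(** * Permutations acting on tuples of indices *)

(** Each tuple is completed to an enumeration of ['I_n] by appending the missing indices; the
    permutation matches the two enumerations entry by entry. *)
Lemma uniq_tuple_perm_ex (n d : nat) (j1 j2 : d.-tuple 'I_n) :
  uniq j1 -> uniq j2 -> exists s : 'S_n, map_tuple s j1 = j2.
Proof.
move=> u1 u2.
pose e (j : d.-tuple 'I_n) : seq 'I_n := j ++ [seq i <- enum 'I_n | i \notin j].
have ue (j : d.-tuple 'I_n) : uniq j -> uniq (e j).
  move=> uj; rewrite cat_uniq uj filter_uniq ?enum_uniq// andbT/=.
  by apply/hasPn => i; rewrite mem_filter => /andP[].
have mem_e (j : d.-tuple 'I_n) i : i \in e j.
  by rewrite mem_cat mem_filter mem_enum andbT orbN.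
have sz_e (j : d.-tuple 'I_n) : uniq j -> size (e j) = n.
  move=> uj; rewrite -[RHS]card_ord cardT; apply/perm_size/uniq_perm => //.
  - exact: ue.
  - exact: enum_uniq.
  - by move=> i; rewrite mem_e mem_enum.
pose s i := nth i (e j2) (index i (e j1)).
have index_lt i : (index i (e j1) < size (e j2))%N.
  by rewrite (_ : size (e j2) = size (e j1)) ?index_mem// !sz_e.
have s_inj : injective s.
  move=> i i' /eqP; rewrite /s (set_nth_default i') ?index_lt// nth_uniq ?ue//.
  by move/eqP/(congr1 (nth i (e j1))); rewrite !nth_index.
exists (perm s_inj); apply: eq_from_tnth => k.
have k1 : (k < size j1)%N by rewrite size_tuple.
have k2 : (k < size j2)%N by rewrite size_tuple.
rewrite tnth_map permE /s (tnth_nth (tnth j2 k) j1).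
rewrite index_cat mem_nth// index_uniq// nth_cat k2.
by rewrite (set_nth_default (tnth j2 k))// -tnth_nth.
Qed.

Lemma symmetric_fun_perm (A : eqType) (B : Type) (d : nat)
    (g : d.-tuple A -> B) (x y : d.-tuple A) :
  symmetric_fun g -> perm_eq x y -> g x = g y.
Proof.
move=> g_sym /tuple_permP[p xE]; rewrite -(g_sym p y); congr g.
by apply: val_inj; rewrite /= xE.
Qed.

Definition sort_ord (n d : nat) (j : d.-tuple 'I_n) : d.-tuple 'I_n :=
  sort_tuple (relpre val leq) j.

Lemma sorted_sort_ord (n d : nat) (j : d.-tuple 'I_n) :
  uniq j -> sorted ltn (map val (sort_ord j)).
Proof.
move=> uj; rewrite ltn_sorted_uniq_leq map_inj_uniq; last exact: val_inj.
rewrite sort_uniq uj/= sorted_map; apply: sort_sorted => a b; exact: leq_total.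
Qed.

Lemma sorted_ltn_uniq (n d : nat) (j : d.-tuple 'I_n) :
  sorted ltn (map val j) -> uniq j.
Proof.
by rewrite ltn_sorted_uniq_leq map_inj_uniq => [/andP[]//|]; exact: val_inj.
Qed.

(** Both sides list the same indices in increasing order, and such a list is unique. Hence permuting
    and re-sorting is invertible on increasing tuples, which encode the [d]-subsets. *)
Lemma sort_ord_perm_id (n d : nat) (s : 'S_n) (j : d.-tuple 'I_n) :
  sorted ltn (map val j) ->
  sort_ord (map_tuple s (sort_ord (map_tuple s^-1%g j))) = j.
Proof.
move=> sj; apply: val_inj; apply: (@sorted_eq _ (relpre val leq)).
- by move=> a b c; exact: leq_trans.
- by move=> a b; rewrite /= -eqn_leq => /eqP/val_inj.
- by apply: sort_sorted => a b; exact: leq_total.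
- by move: sj; rewrite ltn_sorted_uniq_leq sorted_map => /andP[].
- rewrite perm_sort/= (perm_trans (perm_map _ (permEl (perm_sort _ _))))//.
  by rewrite -map_comp map_id_in// => i _ /=; rewrite permKV.
Qed.

(** [s] permutes the [d]-subsets, and symmetry of [g] makes its value depend only on the subset. *)
Lemma sum_sorted_perm (V : zmodType) (n d : nat) (g : d.-tuple 'I_n -> V)
    (s : 'S_n) :
  symmetric_fun g ->
  \sum_(j : d.-tuple 'I_n | sorted ltn (map val j)) g (map_tuple s j) =
  \sum_(j : d.-tuple 'I_n | sorted ltn (map val j)) g j.
Proof.
move=> g_sym.
have sortP (r : 'S_n) (j : d.-tuple 'I_n) : sorted ltn (map val j) ->
    sorted ltn (map val (sort_ord (map_tuple r j))).
  move=> /sorted_ltn_uniq uj; apply: sorted_sort_ord.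
  by rewrite map_inj_uniq//; exact: perm_inj.
rewrite [RHS](reindex_onto (fun j => sort_ord (map_tuple s j))
  (fun j => sort_ord (map_tuple s^-1%g j))); last first.
  by move=> j; exact: sort_ord_perm_id.
apply: eq_big => [j|j _]; last first.
  by apply: symmetric_fun_perm => //; rewrite perm_sym perm_sort.
apply/idP/andP => [sj|[/sorted_ltn_uniq + /eqP <-]].
  split; first exact: sortP.
  by have := sort_ord_perm_id s^-1%g sj; rewrite invgK => ->.
rewrite /= sort_uniq map_inj_uniq => [uj|]; last exact: perm_inj.
by apply: sorted_sort_ord; rewrite map_inj_uniq ?sort_uniq ?map_inj_uniq//;
  exact: perm_inj.
Qed.

(** Some [r] carries [j1] to [j2], and the substitution of [r * s] for [s] is a bijection of the
    group. *)
Lemma sum_perm_uniq (V : zmodType) (n d : nat) (g : d.-tuple 'I_n -> V)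
    (j1 j2 : d.-tuple 'I_n) :
  uniq j1 -> uniq j2 ->
  \sum_(s : 'S_n) g (map_tuple s j1) = \sum_(s : 'S_n) g (map_tuple s j2).
Proof.
move=> u1 u2; have [r <-] := uniq_tuple_perm_ex u1 u2.
rewrite (reindex_inj (mulgI r)); apply: eq_bigr => s _; congr g.
by apply: eq_from_tnth => k; rewrite !tnth_map permM.
Qed.

(* Hoeffding's representation: summing [g (map s j)] over all [s] and all
   increasing [j], the inner sum is independent of [s] when [j] is summed first,
   and of [j] when [s] is summed first. *)
Lemma sum_sorted_avg (R : realType) (n d : nat) (g : d.-tuple 'I_n -> R)
    (j0 : d.-tuple 'I_n) :
  symmetric_fun g -> uniq j0 -> (d <= n)%N ->
  'C(n, d)%:R^-1 * \sum_(j : d.-tuple 'I_n | sorted ltn (map val j)) g j =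
  (n`!)%:R^-1 * \sum_(s : 'S_n) g (map_tuple s j0).
Proof.
move=> g_sym uj0 dn.
have C0 : 'C(n, d)%:R != 0 :> R by rewrite pnatr_eq0 -lt0n bin_gt0.
have n0 : (n`!)%:R != 0 :> R by rewrite pnatr_eq0 -lt0n fact_gt0.
apply: (mulfI C0); rewrite mulVKf//; apply: (mulfI n0).
rewrite mulrCA mulVKf// !mulr_natl.
(* Both multipliers become cardinalities, of the permutations and of the increasing tuples, so each
   side can be read as the same double sum. *)
rewrite -card_ltn_sorted_tuples -sum1dep_card -[in LHS](card_Sn n).
transitivity (\sum_(s : 'S_n) \sum_(j : d.-tuple 'I_n | sorted ltn (map val j))
    g (map_tuple s j)).
  under [RHS]eq_bigr do rewrite sum_sorted_perm//.
  by rewrite sumr_const.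
rewrite exchange_big/= -sumrMnr.
apply: eq_bigr => j sj; rewrite mulr1n.
by apply: sum_perm_uniq => //; exact: sorted_ltn_uniq.
Qed.

(** * Exponential inequalities *)

(** For [x <= 1/2], use [expR x <= 1 / (1 - x) <= 1 + x + 2 x^2], where the second inequality
    amounts to [x^2 (1 - 2 x) >= 0]. For [x > 1/2], already [x <= 2 x^2]. *)
Lemma expR_le_add_expR_sqr (R : realType) (x : R) :
  expR x <= x + expR (2 * x ^+ 2).
Proof.
have [x2|x2] := leP x 2^-1.
  have x1 : 0 < 1 - x by lra.
  apply: (@le_trans _ _ (x + (1 + 2 * x ^+ 2))); last first.
    by rewrite lerD2l expR_ge1Dx.
  rewrite -[x in expR x]opprK expRN.
  apply: (@le_trans _ _ (1 - x)^-1).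
    by rewrite lef_pV2 ?posrE ?expR_gt0// expR_ge1Dx.
  rewrite -[_^-1]mul1r ler_pdivrMr//.
  have : 0 <= x ^+ 2 * (1 - 2 * x) by apply: mulr_ge0; [exact: sqr_ge0|lra].
  by lra.
have x0 : 0 <= x by lra.
apply: (@le_trans _ _ (expR (2 * x ^+ 2))); last by rewrite lerDr.
by rewrite ler_expR expr2; nra.
Qed.

(** Jensen's inequality from the tangent line of [expR] at the mean [m]: the linear terms [x i - m]
    sum to zero. *)
Lemma expR_avg_le (R : realType) (I : finType) (x : I -> R) :
  (0 < #|I|)%N ->
  expR (#|I|%:R^-1 * \sum_i x i) <= #|I|%:R^-1 * \sum_i expR (x i).
Proof.
move=> I0; set m := _ * _.
have I0' : #|I|%:R != 0 :> R by rewrite pnatr_eq0 -lt0n.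
have -> : expR m = #|I|%:R^-1 * \sum_i (expR m * (1 + (x i - m))).
  rewrite -mulr_sumr big_split/= sumrB !sumr_const -(mulr_natl m) mulVKf//.
  by rewrite subrr addr0 mulrCA mulVf// mulr1.
rewrite ler_wpM2l ?invr_ge0//; apply: ler_sum => i _.
rewrite -[x i in leRHS](subrKC m) expRD ler_wpM2l ?expR_ge0//.
exact: expR_ge1Dx.
Qed.

(** In the pointwise bound [expR x <= x + expR (2 x^2)] at [x = l * g w], the linear term integrates
    to zero and the other is at most the constant [c]. *)
Lemma mgf_bounded_le (R : realType) (disp : measure_display)
    (T : measurableType disp) (P : probability T R) (g : T -> R) (b l : R) :
  measurable_fun setT g -> (forall w, `|g w| <= b) ->
  (\int[P]_w (g w)%:E = 0)%E ->
  (\int[P]_w (expR (l * g w))%:E <= (expR (2 * (l * b) ^+ 2))%:E)%E.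
Proof.
move=> mg gb Eg0; set c := expR _.
have gi : P.-integrable setT (EFin \o g).
  apply: measurable_bounded_integrable => //.
    by rewrite [ltLHS]probability_setT ltry.
  exists b; split; first exact: num_real.
  by move=> M bM w _; exact: le_trans (gb w) (ltW bM).
have gli : P.-integrable setT (fun w => l%:E * (g w)%:E)%E.
  exact: integrableZl.
have ci : P.-integrable setT (fun _ => c%:E)%E.
  exact: finite_measure_integrable_cst.
have -> : c%:E = (\int[P]_w (l%:E * (g w)%:E + c%:E))%E.
  rewrite integralD// integralZl// Eg0 mule0 add0e integral_cst//.
  by rewrite [X in (_ * X)%E]probability_setT mule1.
have le_c w : expR (l * g w) <= l * g w + c.
  apply: le_trans (expR_le_add_expR_sqr _) _.
  rewrite lerD2l ler_expR ler_wpM2l// !exprMn ler_wpM2l ?sqr_ge0//.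
  rewrite -[leLHS]real_normK ?num_real// lerXn2r ?nnegrE//.
  exact: le_trans (gb w).
apply: ge0_le_integral => //.
- by apply/measurable_EFinP; apply: measurableT_comp => //; exact: measurable_funM.
- by apply/measurable_EFinP; apply: measurable_funD => //; exact: measurable_funM.
- by move=> w _; rewrite -EFinM -EFinD lee_fin.
Qed.

(** * Moment generating function of the U-statistic and the Chernoff bound *)

Lemma uniq_blocks_ex (I : eqType) (d m : nat) (s : seq I) :
  uniq s -> (m * d <= size s)%N ->
  exists2 js : seq (d.-tuple I), size js = m & uniq (flatten (map val js)).
Proof.
move=> us ms.
(* Cutting a prefix of [s] into consecutive pieces gives a statement that passes through induction;
   distinctness is inherited from [s]. *)
suff [js [szjs jsE]] : exists js : seq (d.-tuple I), size js = m /\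
    flatten (map val js) = take (m * d) s.
  by exists js => //; rewrite jsE take_uniq.
elim: m s ms {us} => [|m IHm] s ms.
  by exists [::]; rewrite mul0n take0.
have sd : size (take d s) == d.
  by rewrite size_takel//; apply: leq_trans ms; rewrite mulSn leq_addr.
have [|js [szjs jsE]] := IHm (drop d s).
  by rewrite size_drop leq_subRL ?(leq_trans _ ms)// mulSn ?leq_addr.
exists (Tuple sd :: js); split; first by rewrite /= szjs.
by rewrite /= jsE mulSn takeD.
Qed.

Lemma measurable_ustat (R : realType) (disp disp' : measure_display)
    (T : measurableType disp) (U : measurableType disp') (P : probability T R)
    (n d : nat) (X : 'I_n -> {RV P >-> U}) (psi : d.-tuple U -> R) (c : R) :
  measurable_fun setT psi ->
  measurable_fun setT (fun w => c *
    \sum_(j : d.-tuple 'I_n | sorted ltn (map val j))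
       apply_rv psi (fun k => X (tnth j k)) w).
Proof.
move=> mpsi; apply: measurable_funM => //.
under eq_fun do rewrite -big_filter.
by apply: measurable_sum => j; exact: (measurable_apply_rv (P := P) X j mpsi).
Qed.

Lemma ustat_mgf_le (R : realType) (disp disp' : measure_display)
    (T : measurableType disp) (U : measurableType disp') (u0 : U)
    (P : probability T R) (n d : nat)
    (X : 'I_n -> {RV P >-> U}) (psi : d.-tuple U -> R) (b l : R)
    (j0 : d.-tuple 'I_n) :
  (0 < d <= n)%N -> iid X -> symmetric_fun psi -> measurable_fun setT psi ->
  (forall x, `|psi x| <= b) -> uniq j0 ->
  (\int[P]_w (apply_rv psi (fun k => X (tnth j0 k)) w)%:E = 0)%E ->
  (\int[P]_w (expR (l * ('C(n, d)%:R^-1 *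
     \sum_(j : d.-tuple 'I_n | sorted ltn (map val j))
        apply_rv psi (fun k => X (tnth j k)) w)))%:E <=
   (expR (2 * (l * b) ^+ 2 / (n %/ d)%:R))%:E)%E.
Proof.
move=> /andP[d0 dn] [Xi Xd] psi_sym mpsi psib uj0 E0.
set k := (n %/ d)%N.
have k0 : k%:R != 0 :> R by rewrite pnatr_eq0 -lt0n divn_gt0.
have [js szjs ujs] : exists2 js : seq (d.-tuple 'I_n), size js = k &
    uniq (flatten (map val js)).
  by apply: (uniq_blocks_ex (enum_uniq 'I_n)); rewrite size_enum_ord leq_trunc_div.
pose g w (j : d.-tuple 'I_n) := apply_rv psi (fun i => X (tnth j i)) w.
have g_sym w : symmetric_fun (g w).
  move=> s j; rewrite /g /apply_rv -[RHS](psi_sym s); congr psi.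
  by apply: eq_from_tnth => i; rewrite !tnth_mktuple.
have js_uniq j : j \in js -> uniq j.
  move=> /path.splitPr jsE; case: jsE ujs => p1 p2.
  by rewrite map_cat flatten_cat/= !cat_uniq => /and3P[_ _ /and3P[]].
pose f (x : d.-tuple U) := expR (l / k%:R * psi x).
have mf : measurable_fun setT f.
  by apply: measurableT_comp => //; exact: measurable_funM.
have f_ge0 x : 0 <= f x by exact: expR_ge0.
(* [a s] is the exponential of [l] times the block mean after relabelling by [s], already written as
   a product over the [k] blocks. *)
pose a (s : 'S_n) w :=
  \prod_(j <- map (map_tuple s) js) apply_rv f (fun i => X (tnth j i)) w.
have a_ge0 s w : 0 <= a s w by apply: prodr_ge0 => j _; exact: f_ge0.
have ma s : measurable_fun setT (a s).
  by apply: measurable_prod => j _; exact: (measurable_apply_rv (P := P) X j mf).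
have map_flat (s : 'S_n) : flatten (map val (map (map_tuple s) js)) =
    map s (flatten (map val js)).
  by rewrite map_flatten -!map_comp.
have Ea s : (\int[P]_w (a s w)%:E <= (expR (2 * (l * b) ^+ 2 / k%:R))%:E)%E.
  rewrite integral_prod_blocks//; last first.
    by rewrite map_flat map_inj_uniq//; exact: perm_inj.
  (* The mean is known to vanish at [j0]; equality in law moves the integral of any block there. *)
  have le1 (j : d.-tuple _) : uniq j ->
      (\int[P]_w (apply_rv f (fun i => X (tnth j i)) w)%:E <=
       (expR (2 * (l / k%:R * b) ^+ 2))%:E)%E.
    move=> uj; rewrite (@integral_uniq_tuple _ _ _ _ _ _ _ _ Xi _ f j j0)//.
    by apply: mgf_bounded_le => //; exact: (measurable_apply_rv (P := P) X j0 mpsi).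
  (* The [k] exponents [2 (l b / k)^2] add up to [2 (l b)^2 / k]. *)
  have -> : expR (2 * (l * b) ^+ 2 / k%:R) =
      \prod_(j <- map (map_tuple s) js) expR (2 * (l / k%:R * b) ^+ 2).
    rewrite big_const_seq count_predT size_map szjs iter_mulr_1 -expRM_natl.
    by congr expR; field.
  rewrite -prodEFin big_seq [leRHS]big_seq.
  (* Nonnegativity is carried along because multiplying inequalities in [\bar R] requires it. *)
  apply: (proj2 (andP (_ : 0 <= _ <= _)%E)).
  apply: (big_ind2 (fun x y => 0 <= x <= y)%E).
  - by rewrite lee01 lexx.
  - move=> x1 x2 y1 y2 /andP[x10 x12] /andP[y10 y12].
    by rewrite mule_ge0//= lee_pmul.
  - move=> j /mapP[i ijs ->]; apply/andP; split.
      by apply: integral_ge0 => w _; rewrite lee_fin; exact: f_ge0.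
    by apply: le1; rewrite map_inj_uniq ?js_uniq//; exact: perm_inj.
have UE w : l * ('C(n, d)%:R^-1 *
    \sum_(j : d.-tuple 'I_n | sorted ltn (map val j)) g w j) =
    #|'S_n|%:R^-1 * \sum_(s : 'S_n) \sum_(j <- js) l / k%:R * g w (map_tuple s j).
  have gE j : j \in js -> 'C(n, d)%:R^-1 *
      \sum_(j : d.-tuple 'I_n | sorted ltn (map val j)) g w j =
      (n`!)%:R^-1 * \sum_(s : 'S_n) g w (map_tuple s j).
    by move=> /js_uniq uj; exact: sum_sorted_avg.
  set S := 'C(n, d)%:R^-1 * _ in gE *.
  (* Every block yields the same permutation average [S]; summing over the [k] blocks puts their sum
     inside the average. *)
  have kS : k%:R * S =
      (n`!)%:R^-1 * \sum_(s : 'S_n) \sum_(j <- js) g w (map_tuple s j).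
    rewrite exchange_big/= mulr_sumr [RHS]big_seq.
    under [RHS]eq_bigr => j jjs do rewrite -gE//.
    by rewrite -big_seq big_const_seq count_predT szjs iter_addr_0 mulr_natl.
  under [in RHS]eq_bigr do rewrite -mulr_sumr.
  by rewrite -mulr_sumr card_Sn [RHS]mulrCA -kS [RHS]mulrA divfK.
have le_avg w : expR (l * ('C(n, d)%:R^-1 *
    \sum_(j : d.-tuple 'I_n | sorted ltn (map val j)) g w j)) <=
    (n`!)%:R^-1 * \sum_(s : 'S_n) a s w.
  rewrite UE; apply: le_trans (expR_avg_le _ _) _.
    by rewrite card_Sn fact_gt0.
  rewrite card_Sn; under eq_bigr do rewrite expR_sum.
  by under [in leRHS]eq_bigr do rewrite /a big_map.
apply: (@le_trans _ _ (\int[P]_w ((n`!)%:R^-1 * \sum_(s : 'S_n) a s w)%:E)%E).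
  apply: ge0_le_integral => //.
  - apply/measurable_EFinP; apply: measurableT_comp => //.
    by apply: measurable_funM => //; exact: (measurable_ustat (P := P) X _ mpsi).
  - apply/measurable_EFinP; apply: measurable_funM => //.
    exact: measurable_sum.
  - by move=> w _; rewrite lee_fin; exact: le_avg.
under eq_integral do rewrite EFinM -sumEFin.
rewrite ge0_integralZl//; last 2 first.
- by apply: emeasurable_sum => s; exact/measurable_EFinP.
- by move=> w _; apply: sume_ge0 => s _; rewrite lee_fin.
rewrite ge0_integral_sum//; last 2 first.
- by move=> s; exact/measurable_EFinP.
- by move=> s w _; rewrite lee_fin.
apply: (@le_trans _ _ ((n`!)%:R^-1%:E *
    \sum_(s : 'S_n) (expR (2 * (l * b) ^+ 2 / k%:R))%:E)%E).
  by rewrite lee_wpmul2l ?lee_fin ?invr_ge0//; apply: lee_sum => s _; exact: Ea.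
rewrite sumEFin -EFinM lee_fin sumr_const card_Sn -[X in _ * X]mulr_natl mulKf//.
Qed.

(* For [c = 0] the right-hand side is [expR 0], since [x / 0 = 0]. *)
Lemma chernoff_subgaussian (R : realType) (disp : measure_display)
    (T : measurableType disp) (P : probability T R) (V : {RV P >-> R})
    (c t : R) :
  (forall r, (\int[P]_w (expR (r * V w))%:E <= (expR (c * r ^+ 2))%:E)%E) ->
  0 <= c -> 0 <= t ->
  (P [set w | (t <= V w)%R] <= (expR (- (t ^+ 2 / (4 * c))))%:E)%E.
Proof.
move=> mgfV c_ge0 t_ge0.
have mV : measurable [set w | t <= V w].
  rewrite (_ : mkset _ = V @^-1` `[t, +oo[).
    by rewrite -[X in measurable X]setTI; exact: measurable_funPT.
  by apply/seteqP; split => w /=; rewrite in_itv/= andbT.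
have [t0|t_neq0] := eqVneq t 0.
  rewrite {2}t0 expr0n mul0r oppr0 expR0; exact: probability_le1.
have [c0|c_neq0] := eqVneq c 0.
  rewrite c0 mulr0 invr0 mulr0 oppr0 expR0; exact: probability_le1.
have c_gt0 : 0 < c by rewrite lt_neqAle eq_sym c_neq0.
have t_gt0 : 0 < t by rewrite lt_neqAle eq_sym t_neq0.
(* This [r] minimizes [c r^2 - r t], with minimum [- t^2 / (4 c)]. *)
pose r := t / (2 * c).
have r_gt0 : 0 < r by rewrite divr_gt0// mulr_gt0.
apply: le_trans (chernoff V t r_gt0) _.
apply: (@le_trans _ _ ((expR (c * r ^+ 2))%:E * (expR (- (r * t)))%:E)%E).
  rewrite lee_wpmul2r ?lee_fin ?expR_ge0// /mmt_gen_fun unlock.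
  under eq_integral do rewrite /= mulrC.
  exact: mgfV.
rewrite -EFinM lee_fin -expRD ler_expR /r le_eqVlt; apply/orP; left; apply/eqP.
by field.
Qed.

(** * Comparison of the constants *)

Lemma fact_le_expn (m : nat) : ((m.+1)`! <= m.+1 ^ m)%N.
Proof.
elim: m => // m IHm; rewrite factS expnS leq_mul//.
by apply: leq_trans IHm _; case: m => // m; rewrite leq_exp2r.
Qed.

(** Since [d! <= d^(d-1)], the numerator is at most [(3 d^2)^(d-1)], and
    [3 d^2 <= d (d+1) (2d+1)]. *)
Lemma kappa_le1 (R : realType) (d : nat) : (0 < d)%N -> kappa_ R d <= 1.
Proof.
case: d => // m _; rewrite /kappa_ /=.
rewrite ler_pdivrMr; last by rewrite exprn_gt0// ltr0n muln_gt0 !addn1.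
rewrite mul1r -!natrX -natrM ler_nat.
apply: (@leq_trans ((m.+1 ^ m) ^ 2 * 3 ^ m)).
  by rewrite leq_mul2r leq_exp2r// fact_le_expn orbT.
rewrite expnAC -expnMn.
by case: m => // m; rewrite leq_exp2r//; lia.
Qed.

Lemma sqrt_kappa_div_gamma_le (R : realType) (d n : nat) : (0 < d <= n)%N ->
  Num.sqrt (kappa_ R d) / gamma_ R d ^+ 2 <= (n %/ d)%:R / n%:R.
Proof.
move=> /andP[d_gt0 dn].
have n_gt0 : (0 < n)%N by exact: leq_trans dn.
have D_gt0 : (0 < d * (d + 1) * (2 * d + 1))%N by rewrite !muln_gt0 !addn1 d_gt0.
rewrite /gamma_ sqr_sqrtr ?divr_ge0// invf_div.
apply: (@le_trans _ _ (6 / (d * (d + 1) * (2 * d + 1))%:R)).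
  rewrite ler_piMl ?divr_ge0// -[leRHS]sqrtr1 ler_wsqrtr//.
  exact: kappa_le1.
rewrite ler_pdivrMr ?ltr0n// mulrAC ler_pdivlMr ?ltr0n//.
rewrite -!natrM ler_nat.
have [d1|d2] := leqP d 1.
  by have -> : d = 1%N by [apply/eqP; rewrite eqn_leq d1]; rewrite divn1 mulnC.
(* The remainder of [n] modulo [d] is below [d], hence at most [(n %/ d) * d]. Then
   [6 n <= 12 d (n %/ d)], and [(d+1) (2d+1) >= 15] for [d >= 2]. *)
have n_le : (n <= 2 * ((n %/ d) * d))%N.
  rewrite {1}(divn_eq n d) mul2n -addnn leq_add2l.
  by rewrite (leq_trans (ltnW (ltn_pmod _ _)))// leq_pmull// divn_gt0.
by nia.
Qed.

(** * Tail bounds for [W_stat] *)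

Theorem theorem3p1 (R : realType) (disp : measure_display)
    (T : measurableType disp) (P : probability T R)
    (d n : nat) (hd : (1 <= d)%N) (hdn : (d <= n)%N)
    (X : 'I_n -> {RV P >-> R}) (hX : iid X)
    (psi : d.-tuple R -> R) (b : R)
    (psi_sym : symmetric_fun psi)
    (psi_meas : measurable_fun [set: d.-tuple R] psi)
    (psi_bdd : (sup_norm psi <= b%:E)%E)
    (hE0 : ('E_P[apply_rv psi (fun k : 'I_d => X (widen_ord hdn k))] = 0)%E)
    (Y : T -> R)
    (hY : is_cond_expectation P
            (sigma_of (X (widen_ord hdn (Ordinal hd))))
            (apply_rv psi (fun k : 'I_d => X (widen_ord hdn k))) Y)
    (hYdeg : (P [set w | Y w = 0%R] < 1)%E)
    (t : R) (ht : 0 <= t) :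
  (P [set w | (t <= W_stat psi X w)%R] <=
     (expR (- (t ^+ 2 * Num.sqrt (kappa_ R d)
               / (8 * b ^+ 2 * gamma_ R d ^+ 2))))%:E)%E /\
  (P [set w | (W_stat psi X w <= - t)%R] <=
     (expR (- (t ^+ 2 * Num.sqrt (kappa_ R d)
               / (8 * b ^+ 2 * gamma_ R d ^+ 2))))%:E)%E.
Proof.
move: hE0; rewrite unlock => hE0'.
pose j0 : d.-tuple 'I_n := [tuple widen_ord hdn k | k < d].
have uj0 : uniq j0.
  by apply/tuple_uniqP => k l; rewrite !tnth_mktuple => /(congr1 val)/= /val_inj.
have psib x : `|psi x| <= b.
  rewrite -lee_fin; apply: le_trans psi_bdd.
  by apply: ereal_sup_ubound; exists x.
have E0 : (\int[P]_w (apply_rv psi (fun k => X (tnth j0 k)) w)%:E = 0)%E.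
  rewrite -[RHS]hE0'; apply: eq_integral => w _; congr (psi _)%:E.
  by apply: eq_from_tnth => k; rewrite !tnth_mktuple.
(* The factor [sqrt n] in [W_stat] turns [l] into [r * sqrt n], so the exponent [2 (l b)^2 / k]
   becomes [c r^2]. *)
pose c : R := 2 * b ^+ 2 * n%:R / (n %/ d)%:R.
have c_ge0 : 0 <= c by rewrite /c divr_ge0// mulr_ge0// mulr_ge0// sqr_ge0.
have mgfW r : (\int[P]_w (expR (r * W_stat psi X w))%:E <=
    (expR (c * r ^+ 2))%:E)%E.
  have -> : c * r ^+ 2 = 2 * (r * Num.sqrt n%:R * b) ^+ 2 / (n %/ d)%:R.
    by rewrite !exprMn sqr_sqrtr// /c; ring.
  have WE w : r * W_stat psi X w = r * Num.sqrt n%:R * ('C(n, d)%:R^-1 *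
      \sum_(j : d.-tuple 'I_n | sorted ltn (map val j))
         apply_rv psi (fun k => X (tnth j k)) w).
    by rewrite /W_stat !mulrA.
  under eq_integral do rewrite WE.
  have hdn' : (0 < d <= n)%N by rewrite hd.
  exact: (@ustat_mgf_le R _ _ T R 0 P n d X psi b (r * Num.sqrt n%:R) j0 hdn' hX
    psi_sym psi_meas psib uj0 E0).
have mW : measurable_fun setT (W_stat psi X) by exact: measurable_ustat.
have expE : expR (- (t ^+ 2 / (4 * c))) <=
    expR (- (t ^+ 2 * Num.sqrt (kappa_ R d) / (8 * b ^+ 2 * gamma_ R d ^+ 2))).
  have n0 : (n%:R : R) != 0 by rewrite pnatr_eq0 -lt0n (leq_trans hd).
  have -> : t ^+ 2 / (4 * c) = t ^+ 2 / (8 * b ^+ 2) * ((n %/ d)%:R / n%:R).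
    have -> : 8 = 4 * 2 :> R by ring.
    rewrite /c !invfM !invrK.
    (* As [b] may be zero, the inverses are treated as independent variables and nothing is
       cancelled. *)
    move: (4^-1) (2^-1) (b ^+ 2)^-1 => x y z.
    by ring.
  rewrite ler_expR lerN2.
  rewrite invfM mulrACA ler_wpM2l//.
    by rewrite divr_ge0 ?sqr_ge0// mulr_ge0// sqr_ge0.
  by apply: sqrt_kappa_div_gamma_le; rewrite hd.
split.
  pose V : {RV P >-> R} := HB.pack (W_stat psi X)
    (isMeasurableFun.Build _ _ _ _ _ mW).
  apply: le_trans (chernoff_subgaussian (V := V) mgfW c_ge0 ht) _.
  by rewrite lee_fin.
have mNW : measurable_fun setT (fun w => - W_stat psi X w).
  exact: measurableT_comp.
pose V : {RV P >-> R} := HB.pack (fun w => - W_stat psi X w)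
  (isMeasurableFun.Build _ _ _ _ _ mNW).
(* The bound [c r^2] is even in [r], so it passes to [- W_stat], whose upper tail is the lower tail
   sought. *)
have mgfV r : (\int[P]_w (expR (r * V w))%:E <= (expR (c * r ^+ 2))%:E)%E.
  rewrite -sqrrN; apply: le_trans (mgfW (- r)); rewrite le_eqVlt.
  by apply/orP; left; apply/eqP; apply: eq_integral => w _; rewrite /= mulrN mulNr.
rewrite (_ : mkset _ = [set w | t <= V w]); last first.
  by apply/seteqP; split => w /=; rewrite lerNr.
apply: le_trans (chernoff_subgaussian mgfV c_ge0 ht) _.
by rewrite lee_fin.
Qed.
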